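(* The elementary cellular automata with numbers $6$, $7$, $23$, $33$, $57$ and $77$ are (Von Neumann) regular as elements of the monoid $\mathrm{End}(\{0,1\}^{\mathbb{Z}})$.
   Context: The full shift $\{0,1\}^{\mathbb{Z}}$ carries the product topology and the shift map $\sigma(x)_i = x_{i+1}$. A cellular automaton on $\{0,1\}^{\mathbb{Z}}$ is a continuous shift-commuting function $\{0,1\}^{\mathbb{Z}} \to \{0,1\}^{\mathbb{Z}}$ (equivalently, a map for which there are some radius $r \in \mathbb{N}$ and a local rule such that $f(x)_i$ is determined by $x|_{[i-r,i+r]}$, independently of $i$). These form a monoid $\mathrm{End}(\{0,1\}^{\mathbb{Z}})$ under composition. For $n \in [0,255]$ with base-$2$ representation $b_7b_6\cdots b_1b_0$ (so $n = \sum_{k=0}^{7} b_k 2^k$), the elementary cellular automaton (ECA) number $n$ is the map $f : \{0,1\}^{\mathbb{Z}} \to \{0,1\}^{\mathbb{Z}}$ with $$f(x)_i = 1 \iff b_{4x_{i-1} + 2x_i + x_{i+1}} = 1.$$ An element $a$ of a semigroup $S$ is (Von Neumann) regular if there is $b \in S$ such that $aba = a$ and $bab = b$. *)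

(* Defs.v *)
From HB Require Import structures.
From mathcomp Require Import all_boot all_order all_algebra.
From mathcomp Require Import all_classical topology.

Set Implicit Arguments.
Unset Strict Implicit.
Unset Printing Implicit Defensive.

Import Order.TTheory GRing.Theory Num.Theory.
Local Open Scope classical_set_scope.
Local Open Scope ring_scope.

Definition vn_regular (S : semigroupType) (a : S) : Prop :=
  exists b : S, (a * b * a = a)%g /\ (b * a * b = b)%g.

(* [prod_topology] carries the product topology; [bool] is discrete. *)
Definition full_shift : Type := prod_topology (fun _ : int => bool).

HB.instance Definition _ := Topological.on full_shift.

Definition shift_map (x : full_shift) : full_shift := fun i => x (i + 1).

Record cellular_automaton := CellularAutomaton {
  ca_fun :> full_shift -> full_shift;
  ca_continuous : continuous ca_fun;
  ca_shift : forall x, ca_fun (shift_map x) = shift_map (ca_fun x)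
}.

Lemma ca_eq (f g : cellular_automaton) : (forall x, f x = g x) -> f = g.
Proof.
case: f g => [f fc fs] [g gc gs] /= /funext fg; subst g.
by congr CellularAutomaton; exact: Prop_irrelevance.
Qed.

Lemma ca_id_shift (x : full_shift) : idfun (shift_map x) = shift_map (idfun x).
Proof. by []. Qed.

Lemma ca_id_continuous : continuous (@idfun full_shift).
Proof. by move=> x; exact: cvg_id. Qed.

Definition ca_id : cellular_automaton :=
  CellularAutomaton ca_id_continuous ca_id_shift.

Lemma ca_comp_continuous (f g : cellular_automaton) : continuous (f \o g).
Proof. by move=> x; apply: continuous_comp; exact: ca_continuous. Qed.

Lemma ca_comp_shift (f g : cellular_automaton) (x : full_shift) :
  (f \o g) (shift_map x) = shift_map ((f \o g) x).
Proof. by rewrite /= !ca_shift. Qed.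

Definition ca_comp (f g : cellular_automaton) : cellular_automaton :=
  CellularAutomaton (@ca_comp_continuous f g) (@ca_comp_shift f g).

Lemma ca_compA : associative ca_comp.
Proof. by move=> f g h; exact: ca_eq. Qed.

Lemma ca_comp1f : left_id ca_id ca_comp.
Proof. by move=> f; exact: ca_eq. Qed.

Lemma ca_compf1 : right_id ca_id ca_comp.
Proof. by move=> f; exact: ca_eq. Qed.

HB.instance Definition _ := gen_eqMixin cellular_automaton.
HB.instance Definition _ := gen_choiceMixin cellular_automaton.
HB.instance Definition _ :=
  isMonoid.Build cellular_automaton ca_compA ca_comp1f ca_compf1.

Definition base2_digit (n k : nat) : bool := odd (n %/ 2 ^ k)%N.

(* The digit index is at most 7, so for n < 256 this reads exactly the base-2 digits
   b_7 ... b_0 of n (and [eca n] depends only on n mod 256 in general). *)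
Definition eca_fun (n : nat) (x : full_shift) : full_shift :=
  fun i => base2_digit n (4 * x (i - 1)%R + 2 * x i + x (i + 1)%R)%N.

Lemma eca_continuous (n : nat) : continuous (eca_fun n).
Proof.
have near_coord (x : full_shift) (i : int) : \forall y \near x, y i = x i.
  apply: (@proj_continuous int (fun _ => bool) i x [set b | b = x i]).
  by rewrite nbhs_principalE; exact/principal_filterP.
move=> x; apply/cvg_sup => i U [V [[W oW <-] Wx] VU].
rewrite /nbhs /=; near=> y; apply: VU => /=.
suff -> : eca_fun n y i = eca_fun n x i by [].
have yl : y (i - 1) = x (i - 1) by near: y; exact: near_coord.
have yc : y i = x i by near: y; exact: near_coord.
have yr : y (i + 1) = x (i + 1) by near: y; exact: near_coord.
by rewrite /eca_fun yl yc yr.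
Unshelve. all: by end_near. Qed.

Lemma eca_shift (n : nat) (x : full_shift) :
  eca_fun n (shift_map x) = shift_map (eca_fun n x).
Proof. by apply/funext => i; rewrite /eca_fun /shift_map addrAC. Qed.

Definition eca (n : nat) : cellular_automaton :=
  CellularAutomaton (@eca_continuous n) (@eca_shift n).

(* Main.v *)
(* If a b a = a then b a b is an inverse of a, so it suffices to exhibit for each
   automaton a cellular automaton b with a b a = a. For automata given by local rules
   this identity only involves finitely many cells, hence can be checked on all binary
   words of a fixed length. The local rules of b were found by SAT solving, the unknowns
   being their values on the words that occur in the image of a. *)
Require Import Defs.
From mathcomp Require Import all_boot all_algebra ring.
From mathcomp Require Import all_classical topology.

Set Implicit Arguments.
Unset Strict Implicit.
Unset Printing Implicit Defensive.

Import GRing.Theory.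
Local Open Scope classical_set_scope.
Local Open Scope ring_scope.

Lemma vn_regular_weak_inverse (S : semigroupType) (a b : S) :
  (a * b * a = a)%g -> vn_regular a.
Proof.
move=> aba; exists (b * a * b)%g; split; first by rewrite !mulgA aba aba.
(* [b * a] is idempotent, which contracts [b a b a b a b] to [b a b] in two steps. *)
have baba : (b * a * b * a = b * a)%g by rewrite -2!(mulgA b) aba.
by rewrite !mulgA !baba.
Qed.

Definition window (x : full_shift) (i : int) (m : nat) : seq bool :=
  mkseq (fun k => x (i + k%:Z)) m.

Definition block_map (l w : nat) (h : seq bool -> bool) (x : full_shift) : full_shift :=
  fun i => h (window x (i - l%:Z) w).

(** Computable counterpart of [block_map] on finite words: one letter for each complete factor of
    length [w]. *)
Definition slide (w : nat) (h : seq bool -> bool) (u : seq bool) : seq bool :=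
  mkseq (fun k => h (take w (drop k u))) ((size u).+1 - w).

Lemma take_drop_window (x : full_shift) (i : int) (m k w : nat) :
  (k + w <= m)%N -> take w (drop k (window x i m)) = window x (i + k%:Z) w.
Proof.
move=> kwm; have wmk : (w <= m - k)%N by rewrite leq_subRL ?(leq_trans (leq_addr _ _) kwm).
have sz : size (take w (drop k (window x i m))) = w.
  by rewrite size_takel // size_drop size_mkseq.
apply: (@eq_from_nth _ false); first by rewrite sz size_mkseq.
move=> j; rewrite sz => jw; rewrite nth_take // nth_drop !nth_mkseq //.
  by rewrite PoszD addrA.
by rewrite (leq_trans _ kwm) // ltn_add2l.
Qed.

(** Transfers identities between configurations to finite words. With the width written [w.+1], the
    source length [m + w] involves no truncated subtraction. *)
Lemma window_block_map (l w : nat) (h : seq bool -> bool) (x : full_shift) i m :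
  window (block_map l w.+1 h x) i m = slide w.+1 h (window x (i - l%:Z) (m + w)).
Proof.
have sz : size (slide w.+1 h (window x (i - l%:Z) (m + w))) = m.
  by rewrite !size_mkseq subSS addnK.
apply: (@eq_from_nth _ false); first by rewrite sz size_mkseq.
move=> j; rewrite size_mkseq => jm; rewrite !nth_mkseq ?size_mkseq ?subSS ?addnK //.
by rewrite take_drop_window ?addnS -?addSn ?leq_add2r // /block_map addrAC.
Qed.

(** The product topology is the supremum of the coordinate topologies, so one output cell suffices.
    It depends on a finite window, on which all configurations close to [x] agree with [x], since
    [bool] is discrete. *)
Lemma block_map_continuous (l w : nat) (h : seq bool -> bool) :
  continuous (block_map l w h).
Proof.
have near_coord (x : full_shift) (i : int) : \forall y \near x, y i = x i.
  apply: (@proj_continuous int (fun _ => bool) i x [set b | b = x i]).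
  by rewrite nbhs_principalE; exact/principal_filterP.
have near_window (x : full_shift) i m : \forall y \near x, window y i m = window x i m.
  elim: m => [|m IHm]; first by near=> y.
  near=> y; rewrite /window !mkseqS; congr rcons; first by near: y.
  by near: y; exact: near_coord.
move=> x; apply/cvg_sup => i U [V [[W oW <-] Wx] VU].
rewrite /nbhs /=; near=> y; apply: VU => /=.
suff -> : block_map l w h y i = block_map l w h x i by [].
by congr h; near: y; exact: near_window.
Unshelve. all: by end_near. Qed.

Lemma block_map_shift (l w : nat) (h : seq bool -> bool) (x : full_shift) :
  block_map l w h (shift_map x) = shift_map (block_map l w h x).
Proof.
apply/funext => i; rewrite /block_map /shift_map; congr h.
by apply: eq_mkseq => k; rewrite addrAC [i + 1 - _]addrAC.
Qed.

Definition block_ca (l w : nat) (h : seq bool -> bool) : cellular_automaton :=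
  CellularAutomaton (@block_map_continuous l w h) (@block_map_shift l w h).

Definition eca_rule (n : nat) (u : seq bool) : bool :=
  base2_digit n (4 * nth false u 0 + 2 * nth false u 1 + nth false u 2)%N.

Lemma eca_block (n : nat) : eca n = block_ca 1 3 (eca_rule n).
Proof.
apply: ca_eq => x; apply/funext => i.
rewrite /= /eca_fun /block_map /eca_rule /window /mkseq /=.
by rewrite addr0 -addrA addNr addr0 -addrA.
Qed.

(** A Boolean quantifier that evaluates without building the list of all [2 ^ m] words. *)
Fixpoint all_words (m : nat) (P : seq bool -> bool) : bool :=
  if m is m'.+1 then
    all_words m' (fun u => P (true :: u)) && all_words m' (fun u => P (false :: u))
  else P [::].

Lemma all_wordsP (m : nat) (P : seq bool -> bool) (u : seq bool) :
  all_words m P -> size u = m -> P u.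
Proof.
elim: m P u => [|m IHm] P [|b u] //= /andP[Pt Pf] [um].
by case: b; [exact: IHm Pt um | exact: IHm Pf um].
Qed.

(* [f], of radius 1, and [g], of radius [r], are local rules; the cell at the centre
   of a word of length 2r + 5 has index r + 1 in its image under [f]. *)
Definition weak_inverse_check (f : seq bool -> bool) (r : nat) (g : seq bool -> bool) :=
  all_words (r.*2 + 5) (fun u =>
    let v := slide 3 f u in slide 3 f (slide r.*2.+1 g v) == [:: nth false v r.+1]).

(** The triple composite has radius [r + 2], so its value at a cell is determined by the word of
    length [2r + 5] centred there, and the check covers all such words. *)
Lemma weak_inverse_checkP (f : seq bool -> bool) (r : nat) (g : seq bool -> bool) :
  weak_inverse_check f r g ->
  (block_ca 1 3 f * block_ca r r.*2.+1 g * block_ca 1 3 f = block_ca 1 3 f)%g.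
Proof.
move=> chk; apply: ca_eq => x; apply/funext => i /=.
(* [j] is the leftmost cell of [y] that the two outer maps read to compute cell [i]; the inner [f]
   reads [x] from [j - 1] on. *)
set y := block_map 1 3 f x; set j := i - 1 - r%:Z.
have szw : size (window x (j - 1) (3 + r.*2 + 2)) = (r.*2 + 5)%N.
  by rewrite size_mkseq -addnA addnC -addnA.
have fxE : slide 3 f (window x (j - 1) (3 + r.*2 + 2)) = window y j (3 + r.*2).
  by rewrite window_block_map.
(* The length drops from [3 + r.*2] to 3 under [g], then to 1 under [f]. *)
have fgyE : slide 3 f (slide r.*2.+1 g (window y j (3 + r.*2))) =
    window (block_map 1 3 f (block_map r r.*2.+1 g y)) i 1.
  by rewrite -(window_block_map r) -(window_block_map 1 2 f _ _ 1).
have /eqP := all_wordsP chk szw; rewrite fxE fgyE nth_mkseq; last first.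
  by rewrite -addnn addnA ltn_addr //; exact: leqnSn.
rewrite /window /mkseq /= addr0 => -[->]; congr (y _).
by rewrite /j -addn1 PoszD; ring.
Qed.

(** A decision list on words of length [2r + 1], here with [r = 3]: the first matching pattern gives
    the value. The identity [a b a = a] constrains it only on words occurring in the image of
    [a]. *)
Definition weak_inverse_rule6 (u : seq bool) : bool :=
  match u with
  | [:: _; _; _; _; true; _; _] => false
  | [:: _; _; _; true; _; _; true] => true
  | [:: _; _; _; true; _; true; _] => true
  | [:: _; _; true; true; _; _; _] => true
  | [:: _; true; true; _; _; _; _] => false
  | [:: _; _; _; false; false; false; _] => true
  | [:: _; _; false; _; false; false; _] => false
  | [:: _; false; false; _; false; _; _] => true
  | [:: true; _; _; false; false; _; _] => false
  | [:: false; _; false; _; false; _; _] => true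
  | _ => false
  end.

Definition weak_inverse_rule7 (u : seq bool) : bool :=
  match u with
  | [:: _; _; _; true; _] => false
  | [:: _; _; false; false; _] => true
  | [:: _; _; _; false; false] => false
  | _ => true
  end.

Definition weak_inverse_rule23 (u : seq bool) : bool :=
  match u with
  | [:: _; false; _; false; _] => true
  | [:: false; _; _; _; false] => false
  | [:: _; true; _; true; _] => false
  | [:: _; _; true; _; false] => false
  | [:: false; _; true; _; _] => false
  | _ => true
  end.

Definition weak_inverse_rule33 (u : seq bool) : bool :=
  match u with
  | [:: _; _; true; _; _] => false
  | [:: _; false; _; false; _] => true
  | [:: true; _; _; false; _] => false
  | [:: _; true; false; _; _] => true
  | [:: _; false; _; _; false] => true
  | _ => false
  end.

Definition weak_inverse_rule57 (u : seq bool) : bool :=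
  match u with
  | [:: _; _; _; _; true; true; _; _; _] => false
  | [:: _; _; _; false; false; _; _; _; _] => true
  | [:: _; _; _; true; _; true; true; _; _] => true
  | [:: _; false; true; _; _; _; true; _; _] => false
  | [:: _; _; false; false; _; false; _; _; _] => false
  | [:: false; _; true; _; _; _; true; _; _] => false
  | [:: _; true; true; true; _; _; _; _; _] => false
  | [:: _; true; true; _; true; _; _; _; _] => true
  | [:: _; _; _; _; true; _; _; false; true] => true
  | [:: _; _; _; _; false; _; false; true; _] => true
  | [:: _; _; _; _; true; _; true; true; _] => true
  | [:: _; _; _; _; _; false; false; false; _] => true
  | [:: _; false; _; _; _; _; false; _; false] => false
  | [:: true; _; _; _; true; _; false; _; _] => false
  | [:: _; _; _; true; true; _; _; false; _] => false
  | [:: _; _; true; true; _; true; _; _; _] => false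
  | [:: _; _; true; _; true; _; _; true; _] => false
  | [:: false; _; _; _; true; _; false; _; _] => false
  | [:: _; false; _; _; _; true; _; _; true] => true
  | [:: _; _; _; _; _; _; false; false; false] => false
  | [:: false; _; _; _; _; true; _; _; true] => true
  | [:: _; _; _; _; _; true; _; false; true] => true
  | [:: _; false; false; _; false; false; _; _; _] => false
  | [:: false; _; _; true; false; _; true; _; _] => false
  | _ => true
  end.

Definition weak_inverse_rule77 (u : seq bool) : bool :=
  match u with
  | [:: _; false; _; false; _] => true
  | [:: true; _; _; _; true] => false
  | [:: _; _; false; _; true] => false
  | [:: false; _; _; false; _] => true
  | [:: true; _; false; _; _] => false
  | [:: _; false; _; _; false] => true
  | _ => false
  end.

Lemma weak_inverse_check_regular (n r : nat) (g : seq bool -> bool) :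
  weak_inverse_check (eca_rule n) r g -> vn_regular (eca n).
Proof.
move=> chk; rewrite eca_block.
exact: vn_regular_weak_inverse (weak_inverse_checkP chk).
Qed.

Theorem theorem4 (n : nat) (hn : n \in [:: 6; 7; 23; 33; 57; 77]) :
  vn_regular (eca n).
Proof.
move: hn; rewrite !inE; do 5?[case/orP]; move=> /eqP ->.
(* The second number is the radius [r] of the weak inverse. Each check runs over [2 ^ (2r + 5)]
   words, at most [2 ^ 13], for automaton 57. *)
- by apply: (@weak_inverse_check_regular 6 3 weak_inverse_rule6); vm_compute.
- by apply: (@weak_inverse_check_regular 7 2 weak_inverse_rule7); vm_compute.
- by apply: (@weak_inverse_check_regular 23 2 weak_inverse_rule23); vm_compute.
- by apply: (@weak_inverse_check_regular 33 2 weak_inverse_rule33); vm_compute.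
- by apply: (@weak_inverse_check_regular 57 4 weak_inverse_rule57); vm_compute.
- by apply: (@weak_inverse_check_regular 77 2 weak_inverse_rule77); vm_compute.
Qed.
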